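(* Let $n\ge 1$, $\alpha\in(\frac12,1)$, let $\mathbf v\in\mathbb R^n$ with $\mathbf v\ge 0$ and $\mathbf 1_n^\top \mathbf v=1$, and let $R\in\mathbb R^{n\times n^2}$ with $R\ge 0$ and $\mathbf 1_n^\top R=\mathbf 1_{n^2}^\top$. Let $\mathbf m$ be the minimal nonnegative solution of $\mathbf x=\alpha R(\mathbf x\otimes\mathbf x)+(1-\alpha)\mathbf v$, set $G'_{\mathbf m}=\alpha R(\mathbf m\otimes I_n)+\alpha R(I_n\otimes\mathbf m)$, and assume that $\mathbf m>0$ and that $G'_{\mathbf m}$ is irreducible. Let $\mathbf s$ be a stochastic solution of the same equation, let $\mathbf y=\mathbf s-\mathbf m$, and let $P_{\mathbf y}=\alpha R(\mathbf y\otimes I_n)+G'_{\mathbf m}$. Then $P_{\mathbf y}$ is nonnegative, irreducible and stochastic (meaning $\mathbf 1_n^\top P_{\mathbf y}=\mathbf 1_n^\top$), and $$\mathbf y=\frac{2\alpha-1}{\alpha}\,\mathcal{PV}(P_{\mathbf y}).$$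
   Context: $\mathbf 1_k$ denotes the column vector of all ones of length $k$; inequalities between vectors and matrices are componentwise; $\otimes$ is the Kronecker product. A vector $\mathbf s\in\mathbb R^n$ is stochastic if $\mathbf s\ge 0$ and $\mathbf 1_n^\top\mathbf s=1$. The minimal nonnegative solution is the (always existing, unique) solution $\mathbf m\ge 0$ such that $\mathbf m\le\mathbf x$ for every solution $\mathbf x\ge 0$. For an irreducible matrix $A\ge 0$, $\mathcal{PV}(A)$ denotes its Perron (right) eigenvector $\mathbf w$, normalized so that $\mathbf 1_n^\top\mathbf w=1$. *)

(* Defs.v *)
From mathcomp Require Import all_boot all_order all_algebra all_fingroup.
From mathcomp Require Import mxtens complex.
From mathcomp Require Import boolp classical_sets reals.

Set Implicit Arguments.
Unset Strict Implicit.
Unset Printing Implicit Defensive.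

Import Order.TTheory GRing.Theory Num.Theory.
Local Open Scope classical_set_scope.
Local Open Scope ring_scope.

Definition ones (K : realType) (k : nat) : 'cV[K]_k := const_mx 1.
Arguments ones {K} k.

Definition mx_le (K : realType) (p q : nat) (A B : 'M[K]_(p, q)) : Prop :=
  forall i j, A i j <= B i j.

Definition mx_lt (K : realType) (p q : nat) (A B : 'M[K]_(p, q)) : Prop :=
  forall i j, A i j < B i j.

Definition stochastic_vec (K : realType) (n : nat) (s : 'cV[K]_n) : Prop :=
  mx_le 0 s /\ (ones n)^T *m s = 1%:M.

(* Columns, not rows, sum to one. *)
Definition col_stochastic (K : realType) (p q : nat) (A : 'M[K]_(p, q)) : Prop :=
  (ones p)^T *m A = (ones q)^T.

(* A is reducible when a simultaneous permutation of its rows and columns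
   brings it to block upper triangular form with two nonempty square diagonal
   blocks, the first of order k; every 1 x 1 matrix is thus irreducible. *)
Definition reducible_mx (K : realType) (n : nat) (A : 'M[K]_n) : Prop :=
  exists (s : 'S_n) (k : nat), (0 < k < n)%N /\
    forall i j : 'I_n, (k <= i)%N -> (j < k)%N ->
      row_perm s (col_perm s A) i j = 0.

Definition irreducible_mx (K : realType) (n : nat) (A : 'M[K]_n) : Prop :=
  ~ reducible_mx A.

(* Complex eigenvalues are used.  The set is finite, and nonempty for 0 < n,
   so the supremum is then a maximum. *)
Definition spectral_radius (K : realType) (n : nat) (A : 'M[K]_n) : K :=
  sup [set ComplexField.Normc.normc z |
        z in [set z : complex K | eigenvalue (map_mx (real_complex K) A) z]].

Definition is_perron_vec (K : realType) (n : nat) (A : 'M[K]_n)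
    (w : 'cV[K]_n) : Prop :=
  [/\ A *m w = spectral_radius A *: w, mx_lt 0 w & (ones n)^T *m w = 1%:M].

(* For an irreducible A >= 0 with 0 < n there is exactly one such w, by
   Perron-Frobenius; the default 0 only concerns other matrices. *)
Definition PV (K : realType) (n : nat) (A : 'M[K]_n) : 'cV[K]_n :=
  xget 0 [set w | is_perron_vec A w].

(* x (x) I_n and I_n (x) x, of formal widths 1 * n and n * 1, as n^2 x n
   matrices. *)
Definition vec_tens_id (K : realType) (n : nat) (x : 'cV[K]_n) :
    'M[K]_(n * n, n) :=
  castmx (erefl, mul1n n) (x *t (1%:M : 'M[K]_n)).

Definition id_tens_vec (K : realType) (n : nat) (x : 'cV[K]_n) :
    'M[K]_(n * n, n) :=
  castmx (erefl, muln1 n) ((1%:M : 'M[K]_n) *t x).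

Definition is_solution (K : realType) (n : nat) (alpha : K)
    (R : 'M[K]_(n, n * n)) (v x : 'cV[K]_n) : Prop :=
  x = alpha *: (R *m (x *t x)) + (1 - alpha) *: v.

Definition is_min_nonneg_solution (K : realType) (n : nat) (alpha : K)
    (R : 'M[K]_(n, n * n)) (v m : 'cV[K]_n) : Prop :=
  [/\ mx_le 0 m, is_solution alpha R v m &
      forall x, mx_le 0 x -> is_solution alpha R v x -> mx_le m x].

Definition G' (K : realType) (n : nat) (alpha : K) (R : 'M[K]_(n, n * n))
    (x : 'cV[K]_n) : 'M[K]_n :=
  alpha *: (R *m vec_tens_id x) + alpha *: (R *m id_tens_vec x).

(* Main.v *)
From mathcomp Require Import boolp classical_sets.
From mathcomp Require Import topology normedtype sequences.
Require Import Defs.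
From mathcomp Require Import all_boot all_order all_algebra all_fingroup.
From mathcomp Require Import mxtens complex reals ring lra.

(** Write F x for the right-hand side of the equation.  Since the columns of R
and the vector v sum to one, the coordinate sum of F x depends only on the sum
t of x: it is alpha t^2 + (1 - alpha), whose fixed points are 1 and
c = (1 - alpha) / alpha, with c < 1 because alpha > 1/2.

The minimal solution m has sum c, not 1 ([minimal_solution_sum]): the iterates
of F from 0 increase and their sums stay below c, so they converge to a
nonnegative solution of sum at most c ([exists_small_solution]), and m lies
below it.

A stochastic solution s lies above m, so y = s - m is nonnegative, of sum
1 - c = (2 alpha - 1) / alpha > 0.  Subtracting the equations of m and s and
expanding s (x) s - m (x) m in powers of y gives P_y y = y
([difference_fixed]).  The matrix P_y dominates G'_m, hence is nonnegative and
irreducible, and its columns sum to alpha (1 - c) + 2 alpha c = 1.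

A column-stochastic nonnegative matrix has spectral radius 1
([spectral_radius_col_stochastic]), and an irreducible one has at most one
fixed vector that is positive of sum one ([irreducible_fixed_gt0],
[irreducible_fixed_unique]); so y divided by its sum is the Perron vector of
P_y ([PV_col_stochastic]). *)

Set Implicit Arguments.
Unset Strict Implicit.
Unset Printing Implicit Defensive.

Import Order.TTheory GRing.Theory Num.Theory numFieldNormedType.Exports.
Local Open Scope ring_scope.

(** * Entries and coordinate sums *)

Lemma mx_ge0P (K : realType) (p q : nat) (A : 'M[K]_(p, q)) :
  mx_le 0 A <-> forall i j, 0 <= A i j.
Proof. by split=> h i j; have := h i j; rewrite mxE. Qed.

Lemma ones_mulmxE (K : realType) (p q : nat) (A : 'M[K]_(p, q)) i j :
  ((ones p)^T *m A) i j = \sum_k A k j.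
Proof. by rewrite mxE; apply: eq_bigr => k _; rewrite !mxE mul1r. Qed.

Lemma col_stochasticP (K : realType) (p q : nat) (A : 'M[K]_(p, q)) :
  col_stochastic A <-> forall j, \sum_i A i j = 1.
Proof.
split=> [h j|h]; first by rewrite -(ones_mulmxE A ord0) h !mxE.
by apply/matrixP => i j; rewrite ones_mulmxE h !mxE.
Qed.

Lemma ones_mul_scalarP (K : realType) (n : nat) (x : 'cV[K]_n) (c : K) :
  (ones n)^T *m x = c%:M <-> \sum_i x i 0 = c.
Proof.
split=> [h|h]; first by rewrite -(ones_mulmxE x 0) h mxE.
by apply/matrixP => i j; rewrite !ord1 ones_mulmxE h mxE.
Qed.

Lemma sum_mulmx_col_stochastic (K : realType) (p q r : nat)
    (A : 'M[K]_(p, q)) (B : 'M[K]_(q, r)) j :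
  col_stochastic A -> \sum_i (A *m B) i j = \sum_k B k j.
Proof.
move=> hA; rewrite -(ones_mulmxE (A *m B) ord0) mulmxA hA.
exact: ones_mulmxE.
Qed.

(** * Irreducible nonnegative matrices *)

(** Reducibility is phrased with permutations and leading blocks; listing S
first and its complement next turns any set of indices into a leading block. *)
Lemma exists_perm_initial_segment (n : nat) (S : {set 'I_n}) :
  exists s : 'S_n, forall i : 'I_n, (s i \in S) = (i < #|S|)%N.
Proof.
set t := enum S ++ enum (~: S).
have st : size t = n by rewrite size_cat -!cardE cardsC card_ord.
have ut : uniq t.
  rewrite cat_uniq !enum_uniq andbT /=; apply/hasPn => x.
  by rewrite !mem_enum in_setC.
have inj_f : injective (fun i : 'I_n => nth i t i).
  move=> i j /eqP; rewrite (set_nth_default i) ?st //.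
  by rewrite nth_uniq ?st // => /eqP/val_inj.
exists (perm inj_f) => i; rewrite permE nth_cat -cardE.
case: ltnP => hi; first by rewrite -mem_enum mem_nth // -cardE.
apply/negbTE; rewrite -in_setC -mem_enum mem_nth // -cardE.
by rewrite ltn_subLR // cardsC card_ord.
Qed.

(** The working form of irreducibility: in the graph of A, with an edge from j
to i when A i j is nonzero, some edge leaves every nonempty proper set of
indices.  Otherwise A would be block triangular
once S is moved to the front. *)
Lemma irreducible_mx_link (K : realType) (n : nat) (A : 'M[K]_n)
    (S : {set 'I_n}) :
  irreducible_mx A -> S != set0 -> S != [set: 'I_n] ->
  exists i j, [/\ i \notin S, j \in S & A i j != 0].
Proof.
move=> hA S0 ST; apply: contra_notP hA => hno.
have [s hs] := exists_perm_initial_segment S.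
exists s, #|S|; split.
  rewrite card_gt0 S0 /= -[X in (_ < X)%N]card_ord -cardsT.
  by apply: proper_card; rewrite properT.
move=> i j hi hj; rewrite !mxE; apply/eqP/negPn/negP => hij.
by apply: hno; exists (s i), (s j); rewrite !hs -leqNgt.
Qed.

Lemma irreducible_mx_le (K : realType) (n : nat) (A B : 'M[K]_n) :
  mx_le 0 A -> mx_le A B -> irreducible_mx A -> irreducible_mx B.
Proof.
move=> A0 AB hA [s [k [hk h]]]; apply: hA; exists s, k; split=> // i j hi hj.
have := h i j hi hj; rewrite !mxE => hB.
apply/eqP; rewrite eq_le -{1}hB AB /=.
by have /mx_ge0P := A0.
Qed.

(** If the support S of x were proper, a nonzero entry P i j with j in S and i
outside would make (P x)_i positive, whereas x_i = 0. *)
Lemma irreducible_fixed_gt0 (K : realType) (n : nat) (P : 'M[K]_n)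
    (x : 'cV[K]_n) :
  irreducible_mx P -> mx_le 0 P -> P *m x = x -> mx_le 0 x -> x != 0 ->
  mx_lt 0 x.
Proof.
move=> irrP P0 Px x0 xn0.
have /mx_ge0P P0' := P0.
have /mx_ge0P x0' := x0.
pose S := [set j | x j 0 != 0].
have [/eqP ST i j|ST] := boolP (S == [set: 'I_n]).
  have : i \in S by rewrite ST inE.
  by rewrite inE ord1 mxE lt0r x0' andbT.
have S0 : S != set0.
  apply: contra xn0 => /eqP S0; apply/eqP/matrixP => i j; rewrite ord1 mxE.
  by apply/eqP/negPn; have := in_set0 i; rewrite -S0 inE => ->.
have [i [j []]] := irreducible_mx_link irrP S0 ST.
rewrite !inE negbK => /eqP xi xj Pij; exfalso.
have := congr1 (fun z : 'cV[K]_n => z i 0) Px; rewrite mxE xi => sum0.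
have term0 k : true -> 0 <= P i k * x k 0 by move=> _; apply: mulr_ge0.
have /(_ j isT)/eqP := psumr_eq0P term0 sum0; rewrite mulf_eq0 (negbTE Pij) /=.
by apply/negP.
Qed.

(** Subtracting from x the largest multiple t z below it leaves a nonnegative
fixed vector with a zero coordinate, which must vanish by
[irreducible_fixed_gt0]; so x is proportional to z. *)
Lemma irreducible_fixed_unique (K : realType) (n : nat) (P : 'M[K]_n)
    (x z : 'cV[K]_n) :
  (0 < n)%N -> irreducible_mx P -> mx_le 0 P ->
  P *m x = x -> P *m z = z -> mx_lt 0 z ->
  \sum_i x i 0 = \sum_i z i 0 -> x = z.
Proof.
move=> n0 irrP P0 Px Pz z0 sxz.
have z0' i : 0 < z i 0 by have := z0 i 0; rewrite mxE.
pose i0 := Ordinal n0.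
(* The largest t is the least ratio x_i / z_i, attained at the index k. *)
case: (@arg_minP _ _ _ i0 predT (fun i => x i 0 / z i 0) isT) => k _ hk.
pose t := x k 0 / z k 0; pose d := x - t *: z.
have d0 : mx_le 0 d.
  move=> i j; rewrite ord1 !mxE subr_ge0 -ler_pdivlMr //; exact: hk.
have Pd : P *m d = d by rewrite mulmxBr -scalemxAr Px Pz.
have dk : d k 0 = 0 by rewrite !mxE /t divfK ?subrr // gt_eqF.
have /eqP : d == 0.
  apply: contraT => dn0.
  by have := irreducible_fixed_gt0 irrP P0 Pd d0 dn0 k 0; rewrite mxE dk ltxx.
move/eqP; rewrite subr_eq0 => /eqP xtz.
have sz : 0 < \sum_i z i 0.
  by rewrite (bigD1 i0) //= ltr_pwDl // sumr_ge0 // => i _; apply: ltW.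
have : t * \sum_i z i 0 = 1 * \sum_i z i 0.
  rewrite mul1r -[in RHS]sxz [in RHS]xtz mulr_sumr.
  by apply: eq_bigr => i _; rewrite mxE.
by move/(mulIf (lt0r_neq0 sz)) => t1; rewrite xtz t1 scale1r.
Qed.

(** * Perron vector of a column-stochastic matrix *)

Lemma normc_sum (K : realType) (I : finType) (f : I -> complex K) :
  ComplexField.Normc.normc (\sum_i f i)
    <= \sum_i ComplexField.Normc.normc (f i).
Proof.
by rewrite -lecR rmorph_sum; exact: (@ler_norm_sum _ (complex K)).
Qed.

(** Eigenvectors act on the left.  At a coordinate k of maximal modulus of a
left eigenvector u, z u_k is a convex combination of the u_j, so |z| <= 1;
the all-ones row vector gives the eigenvalue 1. *)
Lemma spectral_radius_col_stochastic (K : realType) (n : nat) (P : 'M[K]_n) :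
  (0 < n)%N -> mx_le 0 P -> col_stochastic P -> spectral_radius P = 1.
Proof.
move=> n0 P0 /col_stochasticP P1.
have /mx_ge0P P0' := P0.
pose i0 := Ordinal n0.
rewrite /spectral_radius; set E := (X in sup X).
have ubE : ubound E 1.
  move=> _ [z /eigenvalueP [u uz un0] <-].
  pose N j := ComplexField.Normc.normc (u 0 j).
  have N0 j : 0 <= N j by rewrite /N; case: (u 0 j) => a b; apply: sqrtr_ge0.
  case: (@arg_maxP _ _ _ i0 predT N isT) => k _ hk.
  have Nk : 0 < N k.
    rewrite lt0r N0 andbT; apply: contra un0 => /eqP Nk0.
    apply/eqP/matrixP => i j; rewrite ord1 mxE.
    apply: ComplexField.Normc.eq0_normc; apply/eqP; rewrite eq_le N0 andbT -Nk0.
    exact: hk.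
  rewrite -(ler_pM2r Nk) mul1r -ComplexField.Normc.normcM.
  have := congr1 (fun w : 'rV[complex K]_n => w 0 k) uz.
  rewrite !mxE => <-; apply: le_trans (normc_sum _) _.
  rewrite -[leRHS]mulr1 -(P1 k) mulr_sumr; apply: ler_sum => j _.
  rewrite ComplexField.Normc.normcM !mxE {2}/ComplexField.Normc.normc /=.
  rewrite expr0n addr0 sqrtr_sqr ger0_norm //.
  by apply: ler_wpM2r; [|exact: hk].
have E1 : E 1.
  exists 1; last exact: ComplexField.Normc.normc1.
  apply/eigenvalueP; exists (const_mx 1); last first.
    by apply/eqP => /matrixP/(_ 0 i0); rewrite !mxE; apply/eqP; rewrite oner_eq0.
  apply/matrixP => i j; rewrite !mxE mulr1 -[RHS](rmorph1 (real_complex K)) -(P1 j).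
  by rewrite rmorph_sum; apply: eq_bigr => k _; rewrite !mxE mul1r.
apply/eqP; rewrite eq_le; apply/andP; split.
  by apply: ge_sup => //; exists 1.
by apply: ub_le_sup => //; exists 1.
Qed.

(** By irreducibility w is positive, hence a Perron vector, so the choice
defining PV does not fall back on its default; uniqueness identifies the
chosen vector with w. *)
Lemma PV_col_stochastic (K : realType) (n : nat) (P : 'M[K]_n)
    (w : 'cV[K]_n) :
  (0 < n)%N -> mx_le 0 P -> irreducible_mx P -> col_stochastic P ->
  P *m w = w -> stochastic_vec w -> PV P = w.
Proof.
move=> n0 P0 irrP P1 Pw [w0 sw].
have rho1 := spectral_radius_col_stochastic n0 P0 P1.
have wn0 : w != 0.
  apply/eqP => w00; move/ones_mul_scalarP: sw; rewrite w00.
  under eq_bigr do rewrite mxE.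
  by rewrite big1_eq => /esym/eqP; rewrite oner_eq0.
have wpos := irreducible_fixed_gt0 irrP P0 Pw w0 wn0.
have hw : is_perron_vec P w by split; rewrite // rho1 scale1r.
rewrite /PV; case: xgetP => [z _ [Pz z0 sz]|/(_ w)//].
rewrite rho1 scale1r in Pz; apply: (irreducible_fixed_unique n0 irrP P0) => //.
by move/ones_mul_scalarP: sz => ->; move/ones_mul_scalarP: sw => ->.
Qed.

(** * Kronecker products with a vector *)

Lemma vec_tens_idE (K : realType) (n : nat) (x : 'cV[K]_n) k j :
  vec_tens_id x k j
    = x (mxtens_unindex k).1 0 * ((mxtens_unindex k).2 == j)%:R.
Proof.
have jE : (mxtens_unindex (cast_ord (esym (mul1n n)) j)).2 = j.
  by apply: val_inj; rewrite /= modn_small.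
by rewrite castmxE /= cast_ord_id !mxE jE; congr (_ * _);
  congr (x _ _); rewrite [LHS]ord1.
Qed.

Lemma id_tens_vecE (K : realType) (n : nat) (x : 'cV[K]_n) k j :
  id_tens_vec x k j
    = ((mxtens_unindex k).1 == j)%:R * x (mxtens_unindex k).2 0.
Proof.
have jE : (mxtens_unindex (cast_ord (esym (muln1 n)) j)).1 = j.
  by apply: val_inj; rewrite /= divn1.
by rewrite castmxE /= cast_ord_id !mxE jE; congr (_ * _);
  congr (x _ _); rewrite [LHS]ord1.
Qed.

Lemma tens_cVE (K : realType) (n : nat) (x z : 'cV[K]_n) k :
  (x *t z) k 0 = x (mxtens_unindex k).1 0 * z (mxtens_unindex k).2 0.
Proof. by rewrite mxE; congr (x _ _ * z _ _); rewrite [LHS]ord1. Qed.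

Lemma vec_tens_id_mul (K : realType) (n : nat) (x z : 'cV[K]_n) :
  vec_tens_id x *m z = x *t z.
Proof.
apply/matrixP => k j; rewrite [j]ord1 tens_cVE mxE.
rewrite (bigD1 (mxtens_unindex k).2) //= vec_tens_idE eqxx mulr1.
rewrite big1 ?addr0 // => i /negbTE ik.
by rewrite vec_tens_idE eq_sym ik mulr0 mul0r.
Qed.

Lemma id_tens_vec_mul (K : realType) (n : nat) (x z : 'cV[K]_n) :
  id_tens_vec x *m z = z *t x.
Proof.
apply/matrixP => k j; rewrite [j]ord1 tens_cVE mxE.
rewrite (bigD1 (mxtens_unindex k).1) //= id_tens_vecE eqxx mul1r mulrC.
rewrite big1 ?addr0 // => i /negbTE ik.
by rewrite id_tens_vecE eq_sym ik !mul0r.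
Qed.

Lemma sum_delta (K : realType) (n : nat) (j : 'I_n) :
  \sum_(i < n) (i == j)%:R = 1 :> K.
Proof. by rewrite (bigD1 j) //= eqxx big1 ?addr0 // => i /negbTE ->. Qed.

Lemma sum_tens_cV (K : realType) (n : nat) (x z : 'cV[K]_n) :
  \sum_k (x *t z) k 0 = (\sum_i x i 0) * (\sum_i z i 0).
Proof. by rewrite mulr_sum; apply: eq_bigr => k _; rewrite tens_cVE. Qed.

Lemma sum_vec_tens_id (K : realType) (n : nat) (x : 'cV[K]_n) j :
  \sum_k vec_tens_id x k j = \sum_i x i 0.
Proof.
rewrite -[RHS]mulr1 -(sum_delta K j) mulr_sum.
by apply: eq_bigr => k _; rewrite vec_tens_idE.
Qed.

Lemma sum_id_tens_vec (K : realType) (n : nat) (x : 'cV[K]_n) j :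
  \sum_k id_tens_vec x k j = \sum_i x i 0.
Proof.
rewrite -[RHS]mul1r -(sum_delta K j) mulr_sum.
by apply: eq_bigr => k _; rewrite id_tens_vecE.
Qed.

(** * The quadratic map and its minimal fixed point *)

Definition quad_map (K : realType) (n : nat) (alpha : K)
    (R : 'M[K]_(n, n * n)) (v x : 'cV[K]_n) : 'cV[K]_n :=
  alpha *: (R *m (x *t x)) + (1 - alpha) *: v.

Lemma quad_mapE (K : realType) (n : nat) (alpha : K) (R : 'M[K]_(n, n * n))
    (v x : 'cV[K]_n) i :
  quad_map alpha R v x i 0
    = alpha * (\sum_k R i k * (x (mxtens_unindex k).1 0 *
                               x (mxtens_unindex k).2 0))
      + (1 - alpha) * v i 0.
Proof.
rewrite mxE [X in X + _]mxE [X in _ + X]mxE mxE; congr (_ * _ + _).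
by apply: eq_bigr => k _; rewrite -tens_cVE.
Qed.

Lemma sum_quad_map (K : realType) (n : nat) (alpha : K)
    (R : 'M[K]_(n, n * n)) (v x : 'cV[K]_n) :
  col_stochastic R -> stochastic_vec v ->
  \sum_i quad_map alpha R v x i 0
    = alpha * (\sum_i x i 0) ^+ 2 + (1 - alpha).
Proof.
move=> R1 [_ /ones_mul_scalarP v1].
transitivity (alpha * \sum_i (R *m (x *t x)) i 0 + (1 - alpha) * \sum_i v i 0).
  rewrite !mulr_sumr -big_split; apply: eq_bigr => i _.
  by rewrite mxE [X in X + _]mxE [X in _ + X]mxE.
by rewrite v1 mulr1 sum_mulmx_col_stochastic // sum_tens_cV expr2.
Qed.

Lemma le_quad_map (K : realType) (n : nat) (alpha : K)
    (R : 'M[K]_(n, n * n)) (v x z : 'cV[K]_n) :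
  0 <= alpha -> mx_le 0 R -> mx_le 0 x -> mx_le x z ->
  mx_le (quad_map alpha R v x) (quad_map alpha R v z).
Proof.
move=> a0 R0 x0 xz i j; rewrite ord1 !quad_mapE lerD2r ler_wpM2l //.
have /mx_ge0P x0' := x0.
have /mx_ge0P R0' := R0.
by apply: ler_sum => k _; apply: ler_wpM2l => //; apply: ler_pM.
Qed.

Lemma cvg_quad_map (K : realType) (n : nat) (alpha : K)
    (R : 'M[K]_(n, n * n)) (v l : 'cV[K]_n) (u : nat -> 'cV[K]_n) i :
  (forall j, (u k j 0 @[k --> \oo] --> l j 0)%classic) ->
  (quad_map alpha R v (u k) i 0 @[k --> \oo] --> quad_map alpha R v l i 0)%classic.
Proof.
move=> ul; rewrite quad_mapE; under eq_cvg do rewrite quad_mapE.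
apply: cvgD; last exact: cvg_cst.
apply: cvgMl_tmp; apply: cvg_big => [|k _]; first exact: add_continuous.
by apply: cvgMl_tmp; apply: cvgM; apply: ul.
Qed.

(** Monotone iteration from 0.  The bound c satisfies
alpha c^2 + (1 - alpha) = c, so sums below c are preserved by the map; this
bounds the increasing iterates, and their limit is a solution by
continuity. *)
Lemma exists_small_solution (K : realType) (n : nat) (alpha : K)
    (v : 'cV[K]_n) (R : 'M[K]_(n, n * n)) :
  0 < alpha <= 1 -> stochastic_vec v -> mx_le 0 R -> col_stochastic R ->
  exists x, [/\ mx_le 0 x, is_solution alpha R v x &
                \sum_i x i 0 <= (1 - alpha) / alpha].
Proof.
move=> /andP [a0 a1] hv R0 R1; set c := (1 - alpha) / alpha.
have ac : alpha * c = 1 - alpha by rewrite mulrC divfK ?gt_eqF.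
have c0 : 0 <= c by rewrite divr_ge0 ?subr_ge0 // ltW.
have /mx_ge0P v0 := hv.1.
pose F := quad_map alpha R v; pose u k := iter k F 0.
have F0 : mx_le 0 (F 0).
  move=> i j; rewrite ord1 quad_mapE mxE addr_ge0 ?mulr_ge0 ?subr_ge0 ?(ltW a0) //.
  by apply: sumr_ge0 => k _; rewrite !mxE !mulr0.
have u_step k : mx_le 0 (u k) /\ mx_le (u k) (u k.+1).
  elim: k => [|k [u0 uS]]; first by split.
  have u0' : mx_le 0 (u k.+1) by move=> i j; apply: le_trans (u0 i j) (uS i j).
  by split=> //; apply: le_quad_map; rewrite // ltW.
have u_ge0 k i : 0 <= u k i 0 by have /mx_ge0P := (u_step k).1.
have u_sum k : \sum_i u k i 0 <= c.
  elim: k => [|k IH]; first by rewrite big1 // => i _; rewrite mxE.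
  rewrite sum_quad_map //.
  have -> : c = alpha * c ^+ 2 + (1 - alpha).
    by rewrite expr2 mulrA ac mulrBl mul1r ac subrK.
  rewrite lerD2r ler_pM2l //.
  by rewrite lerXn2r ?nnegrE // sumr_ge0.
have u_nd i : nondecreasing_seq (fun k => u k i 0).
  by apply/nondecreasing_seqP => k; apply: (u_step k).2.
pose l : 'cV[K]_n := \col_i sup (range (fun k => u k i 0)).
have ul i : (u k i 0 @[k --> \oo] --> l i 0)%classic.
  rewrite mxE; apply: nondecreasing_cvgn => //.
  exists c => _ [k _ <-]; apply: le_trans (u_sum k).
  by rewrite (bigD1 i) //= lerDl sumr_ge0.
exists l; split.
- by move=> i j; rewrite ord1 mxE; apply: (cvgr_to_ge (ul i)); near=> k.
- apply/matrixP => i j; rewrite ord1.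
  have uSl : (u k.+1 i 0 @[k --> \oo] --> l i 0)%classic.
    by rewrite (cvg_shiftS (fun k => u k i 0)).
  exact: (cvg_unique _ uSl (cvg_quad_map ul)).
- have : (\sum_i u k i 0 @[k --> \oo] --> \sum_i l i 0)%classic.
    by apply: cvg_big => [|i _]; [exact: add_continuous|exact: ul].
  by move/cvgr_to_le; apply; near=> k.
Unshelve. all: by end_near. Qed.

(** The sum M of m is a root of (M - 1) (alpha M - (1 - alpha)), and
[exists_small_solution] rules out M = 1 because (1 - alpha) / alpha < 1. *)
Lemma minimal_solution_sum (K : realType) (n : nat) (alpha : K)
    (v : 'cV[K]_n) (R : 'M[K]_(n, n * n)) (m : 'cV[K]_n) :
  1 / 2 < alpha < 1 -> stochastic_vec v -> mx_le 0 R -> col_stochastic R ->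
  is_min_nonneg_solution alpha R v m ->
  \sum_i m i 0 = (1 - alpha) / alpha.
Proof.
move=> /andP [a12 a1] hv R0 R1 [m0 msol mmin].
have a0 : 0 < alpha by apply: lt_trans a12; rewrite divr_gt0.
have a01 : 0 < alpha <= 1 by rewrite a0 ltW.
have [x [x0 xsol xc]] := exists_small_solution a01 hv R0 R1.
have mc : \sum_i m i 0 <= (1 - alpha) / alpha.
  by apply: le_trans xc; apply: ler_sum => i _; apply: mmin.
set M := \sum_i m i 0 in mc *.
have quadM : M = alpha * M ^+ 2 + (1 - alpha).
  by rewrite -(sum_quad_map _ _ R1 hv); congr (\sum_i _); rewrite {1}msol.
have c1 : (1 - alpha) / alpha < 1.
  by rewrite ltr_pdivrMr // mul1r ltrBlDr; lra.
have M1 : M - 1 != 0 by rewrite subr_eq0 lt_eqF // (le_lt_trans mc).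
have /eqP : (M - 1) * (alpha * M - (1 - alpha)) = 0.
  have -> : (M - 1) * (alpha * M - (1 - alpha))
            = alpha * M ^+ 2 + (1 - alpha) - M by ring.
  by rewrite -quadM subrr.
rewrite mulf_eq0 (negbTE M1) /= subr_eq0 => /eqP <-.
by rewrite mulrC mulKf // gt_eqF.
Qed.

(** * The difference of two solutions *)

Lemma tens_cV_sub_sqr (K : realType) (n : nat) (m s : 'cV[K]_n) :
  s *t s - m *t m = (s - m) *t (s - m) + (m *t (s - m) + (s - m) *t m).
Proof. by apply/matrixP => k j; rewrite !mxE; ring. Qed.

Lemma G'_ge0 (K : realType) (n : nat) (alpha : K) (R : 'M[K]_(n, n * n))
    (x : 'cV[K]_n) :
  0 <= alpha -> mx_le 0 R -> mx_le 0 x -> mx_le 0 (G' alpha R x).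
Proof.
move=> a0 R0 x0 i j; rewrite !mxE.
have /mx_ge0P x0' := x0.
have /mx_ge0P R0' := R0.
by rewrite addr_ge0 // mulr_ge0 // sumr_ge0 // => k _;
  rewrite ?vec_tens_idE ?id_tens_vecE !mulr_ge0 // ler0n.
Qed.

Lemma sum_G' (K : realType) (n : nat) (alpha : K) (R : 'M[K]_(n, n * n))
    (x : 'cV[K]_n) j :
  col_stochastic R ->
  \sum_i G' alpha R x i j = 2 * alpha * \sum_i x i 0.
Proof.
move=> R1.
transitivity (alpha * \sum_i (R *m vec_tens_id x) i j
              + alpha * \sum_i (R *m id_tens_vec x) i j).
  rewrite !mulr_sumr -big_split; apply: eq_bigr => i _.
  by rewrite mxE [X in X + _]mxE [X in _ + X]mxE.
rewrite !sum_mulmx_col_stochastic // sum_vec_tens_id sum_id_tens_vec; ring.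
Qed.

(** P (s - m) collects exactly the three terms in the expansion of
s (x) s - m (x) m around m. *)
Lemma difference_fixed (K : realType) (n : nat) (alpha : K)
    (R : 'M[K]_(n, n * n)) (v m s : 'cV[K]_n) :
  is_solution alpha R v m -> is_solution alpha R v s ->
  (alpha *: (R *m vec_tens_id (s - m)) + G' alpha R m) *m (s - m) = s - m.
Proof.
move=> hm hs; rewrite !mulmxDl -!scalemxAl -!mulmxA.
rewrite !vec_tens_id_mul id_tens_vec_mul -!scalerDr -!mulmxDr -tens_cV_sub_sqr.
by rewrite [in RHS]hs [in RHS]hm [X in _ = _ - X]addrC addrKA mulmxBr scalerBr.
Qed.

Theorem mainTheorem3 (K : realType) (n : nat) (alpha : K)
    (v : 'cV[K]_n) (R : 'M[K]_(n, n * n)) (m s : 'cV[K]_n)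
    (hn : (0 < n)%N)
    (halpha : 1 / 2 < alpha < 1)
    (hv : stochastic_vec v)
    (hR0 : mx_le 0 R) (hR1 : col_stochastic R)
    (hm : is_min_nonneg_solution alpha R v m)
    (hm0 : mx_lt 0 m)
    (hG : irreducible_mx (G' alpha R m))
    (hs : stochastic_vec s) (hs_sol : is_solution alpha R v s) :
  let y := s - m in
  let P := alpha *: (R *m vec_tens_id y) + G' alpha R m in
  [/\ mx_le 0 P, irreducible_mx P, col_stochastic P &
      y = ((2 * alpha - 1) / alpha) *: PV P].
Proof.
move=> y P; have sum_m := minimal_solution_sum halpha hv hR0 hR1 hm.
have [a12 a1] := andP halpha; have a0 : 0 < alpha by lra.
have [m0 msol mmin] := hm; have [s0 /ones_mul_scalarP s1] := hs.
have y0 : mx_le 0 y.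
  by move=> i j; rewrite !mxE subr_ge0; apply: mmin.
set d := (2 * alpha - 1) / alpha.
have d0 : 0 < d by apply: divr_gt0 => //; lra.
have sum_y : \sum_i y i 0 = d.
  transitivity (\sum_i s i 0 - \sum_i m i 0).
    by rewrite -sumrB; apply: eq_bigr => i _; rewrite !mxE.
  rewrite s1 sum_m /d; field; exact: lt0r_neq0.
have G0 := G'_ge0 (ltW a0) hR0 m0.
have GP : mx_le (G' alpha R m) P.
  move=> i j; rewrite [leRHS]mxE lerDr !mxE; apply: mulr_ge0; first exact: ltW.
  apply: sumr_ge0 => k _; rewrite vec_tens_idE; apply: mulr_ge0.
    by have /mx_ge0P := hR0.
  by rewrite mulr_ge0 ?ler0n //; have /mx_ge0P := y0.
have P0 : mx_le 0 P by move=> i j; apply: le_trans (G0 i j) (GP i j).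
have irrP := irreducible_mx_le G0 GP hG.
have P1 : col_stochastic P.
  apply/col_stochasticP => j.
  transitivity (alpha * \sum_i (R *m vec_tens_id y) i j + \sum_i G' alpha R m i j).
    rewrite mulr_sumr -big_split; apply: eq_bigr => i _.
    by rewrite mxE [X in X + _]mxE.
  rewrite sum_mulmx_col_stochastic // sum_vec_tens_id sum_G' // sum_y sum_m /d.
  by field; exact: lt0r_neq0.
have Py : P *m y = y := difference_fixed msol hs_sol.
split=> //.
rewrite (@PV_col_stochastic _ _ _ (d^-1 *: y)) //.
- by rewrite scalerA mulfV ?scale1r // lt0r_neq0.
- by rewrite -scalemxAr Py.
- split.
    apply/mx_ge0P => i j; rewrite mxE; apply: mulr_ge0.
      by rewrite invr_ge0 ltW.
    by have /mx_ge0P := y0.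
  apply/ones_mul_scalarP; under eq_bigr do rewrite mxE.
  by rewrite -mulr_sumr sum_y mulVf // lt0r_neq0.
Qed.
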